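(* Let $\mathcal{O}\subset\mathbb{R}^n$ be an obstacle that is the intersection of a finite number $K$ of primitives $\mathcal{P}_i\subset\mathbb{R}^n$, $i=1,\dots,K$, i.e. $\mathcal{O}=\bigcap_{i=1}^{K}\mathcal{P}_i$. Let the controlled system's shape be described by the set $\mathcal{V}(\vec\xi)\subset\mathbb{R}^n$, depending on the vector of decision variables $\vec\xi$, which is the intersection of a finite number $L$ of primitives $\mathcal{P}_{\mathcal{V},j}(\vec\xi)\subset\mathbb{R}^n$, $j=1,\dots,L$, i.e. $\mathcal{V}(\vec\xi)=\bigcap_{j=1}^{L}\mathcal{P}_{\mathcal{V},j}(\vec\xi)$. Then the signed distance $\mathrm{sd}(\mathcal{V}(\vec\xi),\mathcal{O})$ is bounded from below by $$\max_{i\in\{1,\dots,K\},\ j\in\{1,\dots,L\}}\Big\{\mathrm{sd}\big(\{\vec 0\},\,\mathcal{O}-\mathcal{P}_{\mathcal{V},j}(\vec\xi)\big),\ \mathrm{sd}\big(\{\vec 0\},\,\mathcal{P}_i-\mathcal{V}(\vec\xi)\big)\Big\}\ \le\ \mathrm{sd}(\mathcal{V}(\vec\xi),\mathcal{O}),$$ where the maximum is taken over all $K+L$ listed signed distances.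
   Context: The vector $\vec\xi$ is a vector of real decision variables of a nonlinear program; for each $\vec\xi$, $\mathcal{V}(\vec\xi)$ and $\mathcal{P}_{\mathcal{V},j}(\vec\xi)$ are subsets of $\mathbb{R}^n$. ''Primitives'' are subsets of $\mathbb{R}^n$ (e.g. half-spaces or balls). For sets $\mathcal{V},\mathcal{O}\subset\mathbb{R}^n$ and $\vec p\in\mathbb{R}^n$, write $\mathcal{V}+\vec p=\{\vec v+\vec p : \vec v\in\mathcal{V}\}$, and let $\lVert\cdot\rVert$ be the Euclidean norm. Define the distance $$\mathrm{dist}(\mathcal{V},\mathcal{O})=\inf_{\vec p\in\mathbb{R}^n}\{\lVert\vec p\rVert : (\mathcal{V}+\vec p)\cap\mathcal{O}\neq\emptyset\},$$ the penetration $$\mathrm{pen}(\mathcal{V},\mathcal{O})=\inf_{\vec p\in\mathbb{R}^n}\{\lVert\vec p\rVert : (\mathcal{V}+\vec p)\cap\mathcal{O}=\emptyset\},$$ and the signed distance $$\mathrm{sd}(\mathcal{V},\mathcal{O})=\mathrm{dist}(\mathcal{V},\mathcal{O})-\mathrm{pen}(\mathcal{V},\mathcal{O}).$$ The infimum of the empty set is $+\infty$, so these quantities are extended real numbers. The Minkowski difference of two sets $\mathcal{O},\mathcal{V}\subset\mathbb{R}^n$ is $$\mathcal{O}-\mathcal{V}:=\{\vec o-\vec v\in\mathbb{R}^n : \vec o\in\mathcal{O}\ \text{and}\ \vec v\in\mathcal{V}\}.$$ *)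

(* Defs.v *)
From HB Require Import structures.
From mathcomp Require Import all_boot all_order all_algebra.
From mathcomp Require Import all_classical all_reals ereal.

Set Implicit Arguments.
Unset Strict Implicit.
Unset Printing Implicit Defensive.

Import Order.TTheory GRing.Theory Num.Theory.

Local Open Scope classical_set_scope.
Local Open Scope ring_scope.

Section SignedDistance.
Context {R : realType} {n : nat}.
Implicit Types (p : 'rV[R]_n) (V O A B : set 'rV[R]_n).

(* The norm that MathComp-Analysis puts on 'rV[R]_n is the sup norm, so the
   Euclidean one is introduced here. *)
Definition euclid_norm p : R := Num.sqrt (\sum_(i < n) p ord0 i ^+ 2).

Definition translate V p : set 'rV[R]_n := [set v + p | v in V].

Definition minkowski_diff A B : set 'rV[R]_n :=
  [set a - b | a in A & b in B].

(* [ereal_inf set0 = +oo]. *)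
Definition dist V O : \bar R :=
  ereal_inf [set (euclid_norm p)%:E | p in
             [set p | (translate V p `&` O) !=set0]].

Definition pen V O : \bar R :=
  ereal_inf [set (euclid_norm p)%:E | p in
             [set p | translate V p `&` O = set0]].

(* The form +oo - +oo never occurs: [dist V O = +oo] only if V or O is empty,
   and then [pen V O = 0]. *)
Definition sd V O : \bar R := (dist V O - pen V O)%E.

End SignedDistance.

(* Main.v *)
Require Import Defs.
From mathcomp Require Import all_boot all_order all_algebra.
From mathcomp Require Import all_classical all_reals ereal.

Import Order.TTheory GRing.Theory Num.Theory.

(** A translate [V + p] meets [O] exactly when [p = o - v] for some [o] in [O]
    and [v] in [V], so [sd V O] only depends on the Minkowski difference: it is
    [sd [set 0] (O - V)], the signed distance of the origin to [O - V]
    ([sd_minkowski]). Enlarging an obstacle brings it closer and makes it harder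
    to escape from, so the signed distance is antitone in the obstacle
    ([sd_anti]). Replacing [V] by a primitive [PV j], or [O] by a
    primitive [P i], enlarges an intersection to one of its members, hence enlarges
    [O - V] and can only decrease the signed distance of the origin. Every
    term of the maximum is thus a lower bound. *)

Local Open Scope classical_set_scope.
Local Open Scope ring_scope.

(** Both sides say that [p = o - v] for some [o] in [O] and [v] in [V]. *)
Lemma translate_meets_minkowski (R : realType) (n : nat)
    (V O : set 'rV[R]_n) (p : 'rV[R]_n) :
  (translate V p `&` O) !=set0 <->
  (translate [set 0] p `&` minkowski_diff O V) !=set0.
Proof.
split.
- move=> [_ [[v Vv <-] Ovp]]; exists p; split; first by exists 0; rewrite ?add0r.
  by exists (v + p) => //; exists v => //; rewrite addrC addKr.
- move=> [_ [[_ -> <-] [o Oo [v Vv]]]]; rewrite add0r => ovp.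
  by exists o; split => //; exists v => //; rewrite -ovp addrC subrK.
Qed.

Lemma sd_minkowski (R : realType) (n : nat) (V O : set 'rV[R]_n) :
  sd V O = sd [set 0] (minkowski_diff O V).
Proof.
rewrite /sd /dist /pen.
have meetE p := propext (translate_meets_minkowski _ _ V O p).
congr (_ - _)%E; congr (ereal_inf [set _ | _ in _]); apply/funext => p /=.
- exact: meetE.
- apply/propext; split=> /eqP V0; apply/eqP; move: V0; apply: contraTT => /set0P;
    by [rewrite -meetE => /set0P | rewrite meetE => /set0P].
Qed.

(** A larger obstacle admits more colliding displacements and fewer
    separating ones: the first infimum drops and the second one grows. *)
Lemma sd_anti (R : realType) (n : nat) (V A B : set 'rV[R]_n) :
  A `<=` B -> (sd V B <= sd V A)%E.
Proof.
move=> AB; apply: leeB; apply: ereal_inf_le_tmp; apply: image_subset => p /=.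
- by move=> [x [Vx Ax]]; exists x; split=> //; apply: AB.
- by rewrite -!subset0 => VB0 x [Vx Ax]; apply: (VB0 x); split=> //; apply: AB.
Qed.

Lemma minkowski_diff_subset (R : realType) (n : nat)
    (A A' B B' : set 'rV[R]_n) :
  A `<=` A' -> B `<=` B' -> minkowski_diff A B `<=` minkowski_diff A' B'.
Proof.
by move=> AA' BB' _ [a Aa [b Bb <-]]; exists a; [exact: AA'|exists b => //; exact: BB'].
Qed.

Theorem proposition2 (R : realType) (n m K L : nat)
    (P : 'I_K -> set 'rV[R]_n)
    (O : set 'rV[R]_n)
    (PV : 'I_L -> 'rV[R]_m -> set 'rV[R]_n)
    (V : 'rV[R]_m -> set 'rV[R]_n)
    (hO : O = \bigcap_(i in [set: 'I_K]) P i)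
    (hV : forall xi : 'rV[R]_m, V xi = \bigcap_(j in [set: 'I_L]) PV j xi)
    (xi : 'rV[R]_m) :
  (maxe (\big[maxe/-oo]_(j < L) sd [set 0%R] (minkowski_diff O (PV j xi)))
        (\big[maxe/-oo]_(i < K) sd [set 0%R] (minkowski_diff (P i) (V xi)))
   <= sd (V xi) O)%E.
Proof.
rewrite ge_max (sd_minkowski _ _ (V xi)).
apply/andP; split; apply: bigmax_le => [|k _]; rewrite ?leNye //;
  apply: sd_anti; apply: minkowski_diff_subset => //.
- by rewrite hV; exact: bigcap_inf.
- by rewrite hO; exact: bigcap_inf.
Qed.
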